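(* Let $n,k\geq 2$. There exist motion planning algorithms for $F(\mathbb{R}^n,k)$ with $2k-1$ local rules: there are $2k-1$ pairwise disjoint locally compact subspaces of $F(\mathbb{R}^n,k)\times F(\mathbb{R}^n,k)$ whose union is $F(\mathbb{R}^n,k)\times F(\mathbb{R}^n,k)$, and on each such subspace $W$ a continuous map $s_W: W\to F(\mathbb{R}^n,k)^I$ such that $s_W(x,y)(0)=x$ and $s_W(x,y)(1)=y$ for all $(x,y)\in W$.
   Context: $F(\mathbb{R}^n,k)=\{(x_1,\ldots,x_k)\in (\mathbb{R}^n)^k : x_i\neq x_j \text{ for } i\neq j\}$. $I=[0,1]$, and $F(\mathbb{R}^n,k)^I$ is the space of continuous paths $I\to F(\mathbb{R}^n,k)$ with the compact-open topology. *)

(* Defs.v *)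
From HB Require Import structures.
From mathcomp Require Import all_boot all_order all_algebra.
From mathcomp Require Import all_classical all_reals all_analysis.
Import Order.TTheory GRing.Theory Num.Theory.
Import numFieldNormedType.Exports.

Set Implicit Arguments.
Unset Strict Implicit.
Unset Printing Implicit Defensive.

Local Open Scope classical_set_scope.
Local Open Scope ring_scope.

(* A set [A] coerces to the type [set_type A] of its elements, which carries
   the initial topology for the inclusion. All subspaces below are these types,
   so that compactness and continuity are intrinsic to the subspace. *)

Definition conf_set (R : realType) (n k : nat) :
    set {ptws 'I_k -> 'rV[R]_n} :=
  [set x | forall i j, i != j -> x i != x j].

Definition conf (R : realType) (n k : nat) : topologicalType :=
  set_type (@conf_set R n k).

Definition unit_interval (R : realType) : topologicalType :=
  set_type (`[0, 1]%classic : set R).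

Lemma zero_in_unit_interval (R : realType) : (0 : R) \in (`[0, 1]%classic : set R).
Proof. by rewrite inE /= in_itv /= lexx ler01. Qed.

Lemma one_in_unit_interval (R : realType) : (1 : R) \in (`[0, 1]%classic : set R).
Proof. by rewrite inE /= in_itv /= ler01 lexx. Qed.

Definition I0 (R : realType) : unit_interval R :=
  exist _ 0 (zero_in_unit_interval R).
Definition I1 (R : realType) : unit_interval R :=
  exist _ 1 (one_in_unit_interval R).

(* The library puts no default topology on [continuousType]; this alias carries
   the one induced from the compact-open topology on all functions. *)
Definition path_space (R : realType) (X : topologicalType) : Type :=
  continuousType (unit_interval R) X.

HB.instance Definition _ (R : realType) (X : topologicalType) :=
  Choice.on (path_space R X).
HB.instance Definition _ (R : realType) (X : topologicalType) :=
  Topological.copy (path_space R X)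
    (initial_topology
       (id : path_space R X -> {compact-open, unit_interval R -> X})).

Definition path_at (R : realType) (X : topologicalType)
  (p : path_space R X) (t : unit_interval R) : X := Continuous.sort p t.

(* Main.v *)
Require Import Defs.
From HB Require Import structures.
From mathcomp Require Import all_boot all_order all_algebra.
From mathcomp Require Import all_classical all_reals all_analysis.
From mathcomp Require Import zify ring lra.
Import Order.TTheory GRing.Theory Num.Theory.
Import numFieldNormedType.Exports.

(* Project configurations to the first coordinate, and let c(x), between 1 and
   k, be the number of distinct projections of x. It is lower semicontinuous, so
   on the stratum c(x) + c(y) = m both summands, and then also the patterns of
   ties among the projections, are locally constant. The 2k-1 strata
   m = 2, ..., 2k are the domains. Translating the a-th point by (gap x) a / k
   along the first axis separates all projections, where [gap x], a lower bound
   of the nonzero gaps, is continuous on strata. One can simultaneously bring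
   the second coordinate of the a-th point to the value a. After doing so for
   both x and y, a straight line joins the two results, since second coordinates
   stay distinct along it. *)

Set Implicit Arguments.
Unset Strict Implicit.
Unset Printing Implicit Defensive.

Local Open Scope classical_set_scope.
Local Open Scope ring_scope.

(** * Counting the values of a finite family *)

(* One index per fiber of [f], so [#|leaders f|] counts the values of [f]. *)
Definition leaders (k : nat) (T : eqType) (f : 'I_k -> T) : {set 'I_k} :=
  [set a : 'I_k | [forall b : 'I_k, (b < a)%N ==> (f b != f a)]]%SET.

Section leaders.
Context {k : nat} {T : eqType}.
Implicit Types f g : 'I_k -> T.

Lemma leaders_min f (a : 'I_k) : exists2 l : 'I_k, l \in leaders f & f l = f a.
Proof.
pose P (l : 'I_k) := f l == f a.
have Pa : P a by exact: eqxx.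
case: (@arg_minnP _ a P (@nat_of_ord k) Pa) => l /eqP fl lmin.
exists l => //; rewrite inE; apply/forallP => b; apply/implyP => bl.
apply: contraTN bl => /eqP fb; rewrite -leqNgt; apply: lmin.
by rewrite /P fb fl.
Qed.

Lemma leaders_inj f : {in leaders f &, injective f}.
Proof.
move=> l m; rewrite !inE => /forallP lP /forallP mP flm.
have [lm|ml|/val_inj//] := ltngtP l m.
  by have := implyP (mP l) lm; rewrite flm eqxx.
by have := implyP (lP m) ml; rewrite flm eqxx.
Qed.

Lemma leadersS f g :
  (forall a b : 'I_k, g a = g b -> f a = f b) -> leaders f \subset leaders g.
Proof.
move=> gf; apply/fintype.subsetP => l; rewrite !inE => /forallP lP.
apply/forallP => b; apply/implyP => /(implyP (lP b)).
by apply: contra_neq => /gf.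
Qed.

(** The first hypothesis gives [leaders f \subset leaders g], and the cardinalities force equality.
    The [g]-leaders of [a] and [b] are then [f]-leaders with the same [f]-value, hence one index. *)
Lemma leaders_ker f g :
  (forall a b : 'I_k, g a = g b -> f a = f b) ->
  (#|leaders g| <= #|leaders f|)%N ->
  forall a b : 'I_k, f a = f b -> g a = g b.
Proof.
move=> gf card_le a b fab.
have lfg : leaders f = leaders g by apply/eqP; rewrite eqEcard leadersS.
have [l lg gl] := leaders_min g a; have [m mg gm] := leaders_min g b.
rewrite -gl -gm; congr g; apply: (@leaders_inj f); rewrite ?lfg//.
by rewrite (gf _ _ gl) (gf _ _ gm).
Qed.

Lemma eq_leaders f g :
  (forall a b : 'I_k, f a = f b <-> g a = g b) -> leaders f = leaders g.
Proof.
by move=> fg; apply/eqP; rewrite finset.eqEsubset !leadersS// => a b /fg.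
Qed.

Lemma card_leaders_le f : (#|leaders f| <= k)%N.
Proof. by rewrite -[leqRHS]card_ord max_card. Qed.

Lemma card_leaders_gt0 f : (0 < k)%N -> (0 < #|leaders f|)%N.
Proof.
move=> k0; have [l lf _] := leaders_min f (Ordinal k0).
by apply/card_gt0P; exists l.
Qed.

End leaders.

(** * Compact sets in initial topologies and subspaces *)

(** A cluster point of the image filter in [K] has the form [f x]. Basic neighborhoods of [x] are
    preimages of open sets, so they meet every member of the filter. *)
Lemma compact_preimage_initial (S : choiceType) (T : topologicalType)
    (f : S -> T) (K : set T) :
  compact K -> K `<=` range f ->
  compact (f @^-1` K : set (initial_topology f)).
Proof.
move=> Kc Kf F PF FK.
have [y [Ky cy]] := Kc (f @ F) _ FK.
have [x _ fx] := Kf y Ky; subst y.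
exists x; split=> // A B FA [_ [[U oU <-] Ux] UB].
have FfA : F (f @^-1` (f @` A)) by apply: filterS FA => a Aa; exists a.
have [_ [[a Aa <-] Ua]] := cy _ _ FfA (open_nbhs_nbhs (conj oU Ux)).
by exists a; split=> //; exact: UB.
Qed.

Lemma compact_set_val (T : topologicalType) (A K : set T) :
  compact K -> K `<=` A -> compact (set_val @^-1` K : set (set_type A)).
Proof.
move=> Kc KA; apply: compact_preimage_initial => // x Kx.
by exists (SigSub (mem_set (KA x Kx))).
Qed.

Lemma set_val_continuous (T : topologicalType) (A : set T) :
  continuous (set_val : set_type A -> T).
Proof. exact: initial_continuous. Qed.

(** * Compact boxes around a configuration *)

Section box.
Context {R : realType} {n k : nat}.
Local Notation E := {ptws 'I_k -> 'rV[R]_n}.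

Definition box (x : E) (r : R) : set E :=
  [set x' | forall a c, `|x' a 0 c - x a 0 c| <= r].

Lemma eval_coord_continuous a c : continuous (fun x : E => x a 0 c).
Proof.
move=> x.
apply: (@continuous_comp E 'rV[R]_n R (fun x => x a) (fun v => v 0 c)).
  exact: (@proj_continuous 'I_k (fun=> 'rV[R]_n) a).
exact: coord_continuous.
Qed.

Lemma box_nbhs x r : 0 < r -> nbhs x (box x r).
Proof.
move=> r0.
apply: (@filter_forall E 'I_k (fun a x' => forall c,
  `|x' a 0 c - x a 0 c| <= r) (nbhs x) (nbhs_filter x)) => a.
apply: (@filter_forall E 'I_n (fun c x' => `|x' a 0 c - x a 0 c| <= r)
  (nbhs x) (nbhs_filter x)) => c.
have /cvgrPdist_le/(_ _ r0) := @eval_coord_continuous a c x.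
by apply: filterS => x'; rewrite distrC.
Qed.

Lemma box_compact x r : compact (box x r).
Proof.
have := @tychonoff 'I_k (fun=> 'rV[R]_n) (fun a => [set v : 'rV[R]_n |
  forall c, `[x a 0 c - r, x a 0 c + r]%classic (v ord0 c)]).
rewrite (_ : [set f | _] = box x r); last first.
  apply/seteqP; split=> x' h a c; have := h a c; rewrite /= in_itv/=;
    by rewrite ler_distl.
apply => a; apply: (@rV_compact R n
  (fun c => `[x a 0 c - r, x a 0 c + r]%classic)) => c.
exact: segment_compact.
Qed.

(** Close to [x] no new coordinate ties appear. Two values moved by at most a quarter of the least
    nonzero difference cannot meet unless they were equal. *)
Lemma box_separating (x : E) : exists2 r : R, 0 < r &
  forall x', box x r x' -> forall a b c, x' a 0 c = x' b 0 c ->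
  x a 0 c = x b 0 c.
Proof.
pose d (p : 'I_k * 'I_k * 'I_n) := `|x p.1.1 0 p.2 - x p.1.2 0 p.2|.
(* The default 1 keeps [m] positive when all differences vanish. *)
pose m := \big[Num.min/1]_(p | d p != 0) d p.
have m0 : 0 < m.
  rewrite /m; elim/big_ind : _ => // [u v u0 v0|p dp].
    by rewrite lt_min u0.
  by rewrite lt_def dp normr_ge0.
have dm p : d p != 0 -> m <= d p by move=> dp; exact: bigmin_le_cond.
exists (m / 4); first by rewrite divr_gt0.
move=> x' bx' a b c x'ab; apply/eqP; rewrite -subr_eq0 -normr_eq0.
apply/negP => /negP /(dm (a, b, c)); rewrite /d/= => mle.
have : `|x a 0 c - x b 0 c| <= m / 4 + m / 4.
  rewrite -(subrKA (x' a 0 c)) (le_trans (ler_normD _ _))// lerD//.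
    by rewrite distrC.
  by rewrite x'ab.
by move=> /(le_trans mle); lra.
Qed.
End box.

Section subspace_of_product.
Context {T U : topologicalType} (W : set (T * U)).

Lemma continuous_val_fst : continuous (fun w : set_type W => (set_val w).1).
Proof.
move=> w; apply: (@continuous_comp _ (T * U)%type).
  exact: set_val_continuous.
exact: cvg_fst.
Qed.

Lemma continuous_val_snd : continuous (fun w : set_type W => (set_val w).2).
Proof.
move=> w; apply: (@continuous_comp _ (T * U)%type).
  exact: set_val_continuous.
exact: cvg_snd.
Qed.

End subspace_of_product.

(** * Strata by the number of projections, and their local compactness *)

Section strata.
Context {R : realType} {n k : nat} (i : 'I_n).
Local Notation E := {ptws 'I_k -> 'rV[R]_n}.
Local Notation conf := (conf R n k).

Definition nb_proj (x : E) : nat := #|leaders (fun a => x a 0 i)|.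

Definition preserves_ties (x x' : E) :=
  forall a b, x a 0 i = x b 0 i -> x' a 0 i = x' b 0 i.

Lemma closed_preserves_ties x : closed [set x' | preserves_ties x x'].
Proof.
rewrite (_ : [set _ | _] = \bigcap_(p in [set p | x p.1 0 i = x p.2 0 i])
  [set x' : E | x' p.1 0 i - x' p.2 0 i = 0]); last first.
  apply/seteqP; split=> [x' h [a b] /= xab|x' h a b xab].
    by rewrite (h a b)// subrr.
  by apply/eqP; rewrite -subr_eq0; apply/eqP; exact: (h (a, b)).
apply: closed_bigI => -[a b] _ /=.
apply: (@closed_comp E R (fun x' : E => x' a 0 i - x' b 0 i) [set y | y = 0]).
  move=> x' _; apply: (@cvgB R R^o E (nbhs x') (nbhs_filter x')).
    exact: (@eval_coord_continuous R n k a i x').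
  exact: (@eval_coord_continuous R n k b i x').
exact: closed_eq.
Qed.

(** Ties near [x] are already ties of [x], whence semicontinuity; when the counts agree,
    [leaders_ker] reverses the implication. *)
Lemma near_ties (x : E) : \forall x' \near x,
  (nb_proj x <= nb_proj x')%N /\
  (nb_proj x' = nb_proj x -> preserves_ties x x').
Proof.
have [r r0 sep] := box_separating x.
apply: filterS (box_nbhs x r0) => x' /sep h; split.
  by apply/subset_leq_card/leadersS => a b; exact: h.
move=> eq_nb; apply: leaders_ker => [a b|]; first exact: h.
by rewrite -/(nb_proj x) -eq_nb.
Qed.

Lemma stratum_compact_nbhs (x : conf) : exists K : set conf,
  [/\ compact K, closed K,
   forall x', K x' -> nb_proj (\val x') = nb_proj (\val x) &
   \forall x' \near x, nb_proj (\val x') = nb_proj (\val x) -> K x'].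
Proof.
have [r r0 sep] := box_separating (\val x).
(* On [K] ties are kept and none are created, so the count is constant. The box works on all
   coordinates, not only on [i], so that distinct points stay distinct and [K] consists of
   configurations. *)
pose K := box (\val x) r `&` [set x' | preserves_ties (\val x) x'].
have Kc : compact K.
  by apply: compact_closedI; [exact: box_compact|exact: closed_preserves_ties].
have Kcl : closed K.
  apply: compact_closed => //; apply: hausdorff_product => _.
  exact: norm_hausdorff.
have Kconf : K `<=` @conf_set R n k.
  move=> x' [/sep h _] a b ab; apply/negP => /eqP x'ab.
  have /negP := set_mem (valP x) a b ab; apply; apply/eqP/rowP => c.
  by apply: h; rewrite x'ab.
exists (set_val @^-1` K); split.
- exact: compact_set_val.
- by apply: closed_comp => // x' _; exact: set_val_continuous.
- move=> x' [/sep h ties]; rewrite /nb_proj.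
  rewrite (@eq_leaders _ _ _ (fun a => (\val x : E) a 0 i))// => a b.
  by split; [exact: h|exact: ties].
- have := @set_val_continuous _ _ x _
    (@filterI _ _ (nbhs_filter (\val x)) _ _ (box_nbhs (\val x) r0)
      (near_ties (\val x))).
  by apply: (@filterS _ _ (nbhs_filter x)) => x' [bx' [_ h]] /h.
Qed.

Definition stratum (m : nat) : set (conf * conf) :=
  [set xy | (nb_proj (\val xy.1) + nb_proj (\val xy.2))%N = m].

(** Neither count can drop near [w], and their sum is fixed, so neither can rise. *)
Lemma near_stratum m (w : set_type (stratum m)) : \forall w' \near w,
  [/\ nb_proj (\val (\val w').1) = nb_proj (\val (\val w).1),
      nb_proj (\val (\val w').2) = nb_proj (\val (\val w).2),
      preserves_ties (\val (\val w).1) (\val (\val w').1) &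
      preserves_ties (\val (\val w).2) (\val (\val w').2)].
Proof.
have n1 := @continuous_val_fst _ _ (stratum m) w _
  (@set_val_continuous _ _ (\val w).1 _ (near_ties (\val (\val w).1))).
have n2 := @continuous_val_snd _ _ (stratum m) w _
  (@set_val_continuous _ _ (\val w).2 _ (near_ties (\val (\val w).2))).
apply: (@filterS2 _ _ (nbhs_filter w)) n1 n2 => w' [le1 h1] [le2 h2].
have := set_mem (valP w); have := set_mem (valP w'); rewrite /stratum/= => e' e.
have e1 : nb_proj (\val (\val w').1) = nb_proj (\val (\val w).1).
  apply/eqP; rewrite eqn_leq le1 andbT leqNgt; apply/negP => lt1.
  by have := leq_add lt1 le2; rewrite addSn e e' ltnn.
have e2 : nb_proj (\val (\val w').2) = nb_proj (\val (\val w).2).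
  by apply/eqP; rewrite -(eqn_add2l (nb_proj (\val (\val w).1))) -{1}e1 e e'.
by split=> //; [exact: h1|exact: h2].
Qed.

Lemma stratum_locally_compact m : locally_compact [set: set_type (stratum m)].
Proof.
move=> w _; have [K [Kc Kcl Kcp nK]] := stratum_compact_nbhs (\val w).1.
have [L [Lc Lcl Lcp nL]] := stratum_compact_nbhs (\val w).2.
(* Both counts are constant on the factors, so the whole product lies in the stratum and remains
   compact there. *)
have KLm : K `*` L `<=` stratum m.
  move=> xy [/Kcp e1 /Lcp e2]; rewrite /stratum /= e1 e2.
  exact: (set_mem (valP w)).
exists (set_val @^-1` (K `*` L)); last first.
  split; first by apply: compact_set_val => //; exact: compact_setX.
  apply: closed_comp => [w' _|]; first exact: set_val_continuous.
  apply: closedI.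
    apply: (@closed_comp (conf * conf)%type conf fst) => // ? _.
    exact: cvg_fst.
  apply: (@closed_comp (conf * conf)%type conf snd) => // ? _.
  exact: cvg_snd.
have n1 := @continuous_val_fst _ _ (stratum m) w _ nK.
have n2 := @continuous_val_snd _ _ (stratum m) w _ nL.
apply: (@filterS3 _ _ (nbhs_filter w)) (near_stratum w) n1 n2.
by move=> w' [e1 e2 _ _] h1 h2 _; split; [exact: h1|exact: h2].
Qed.

End strata.

Lemma continuous_ptws (I : Type) (T U : topologicalType)
    (f : T -> {ptws I -> U}) :
  (forall a, continuous (fun x => f x a)) -> continuous f.
Proof.
move=> cf x; apply/cvg_sup => a A [_ [[B oB <-] Bx] /filterS]; apply.
by apply: (cf a x); exact: open_nbhs_nbhs.
Qed.

(** * The three-leg motion and its avoidance of collisions *)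

Section motion.
Context {R : realType} {n k : nat} (i j : 'I_n).
Hypothesis ij : i != j.
Local Notation E := {ptws 'I_k -> 'rV[R]_n}.
Local Notation conf := (conf R n k).

(* Pairs with tied projections contribute nothing, since [0^-1 = 0]; the value
   is thus a positive lower bound of the nonzero gaps, without a minimum. *)
Definition gap (x : E) : R :=
  (1 + \sum_(p : 'I_k * 'I_k) `|x p.1 0 i - x p.2 0 i|^-1)^-1.

Let gap_den_gt0 (x : E) :
  0 < 1 + \sum_(p : 'I_k * 'I_k) `|x p.1 0 i - x p.2 0 i|^-1.
Proof. by rewrite ltr_wpDr// sumr_ge0. Qed.

Lemma gap_gt0 x : 0 < gap x. Proof. by rewrite invr_gt0. Qed.

Lemma gap_le (x : E) a b : x a 0 i != x b 0 i -> gap x <= `|x a 0 i - x b 0 i|.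
Proof.
rewrite -subr_eq0 -normr_gt0 => d0.
rewrite -[leRHS]invrK lef_pV2 ?posrE ?invr_gt0//.
(* The inverse of this gap is one of the nonnegative summands of the denominator. *)
by rewrite (bigD1 (a, b))//= addrCA lerDl addr_ge0// sumr_ge0.
Qed.

(** Tied projections are separated by the distinct shifts. Untied ones are at least [gap x] apart,
    while two shifts differ by less than [s * k%:R]. *)
Lemma shift_injective (x : E) s :
  0 < s -> s * k%:R <= gap x -> injective (fun a => x a 0 i + s * a%:R).
Proof.
move=> s0 sk a b /= e; apply/val_inj/eqP; rewrite -(eqr_nat R).
have eb : x a 0 i - x b 0 i = s * (b%:R - a%:R) by lra.
have [xab|/gap_le] := eqVneq (x a 0 i) (x b 0 i).
  move: e; rewrite xab => /addrI /mulfI h; apply/eqP/h; exact: lt0r_neq0.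
rewrite eb normrM (gtr0_norm s0) => /(le_trans sk).
rewrite ler_pM2l// leNgt => /negP[].
have ak : (a%:R : R) < k%:R by rewrite ltr_nat.
have bk : (b%:R : R) < k%:R by rewrite ltr_nat.
have a0 : 0 <= (a%:R : R) by [].
have b0 : 0 <= (b%:R : R) by [].
by rewrite ltr_norml; apply/andP; split; lra.
Qed.

(** The factor [gap x / k%:R] is the largest [s] that [shift_injective] allows. *)
Definition spread (x : E) : E := fun a =>
  x a + (gap x / k%:R * a%:R) *: delta_mx 0 i +
  (a%:R - x a 0 j) *: delta_mx 0 j.

Lemma spread_fst x a : spread x a 0 i = x a 0 i + gap x / k%:R * a%:R.
Proof. by rewrite !mxE !eqxx/= (negbTE ij) /= mulr1 mulr0 addr0. Qed.

Lemma spread_snd x a : spread x a 0 j = a%:R.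
Proof.
by rewrite !mxE !eqxx/= eq_sym (negbTE ij) /= mulr1 mulr0 addr0 addrC subrK.
Qed.

(** One formula for three straight legs: raising [u], then [v], then [w] from 0 to 1 leads from [x]
    to [spread x], to [spread y], to [y]. *)
Definition motion (x y : E) (u v w : R) : E := fun a =>
  (1 - u) *: x a + (u - v) *: spread x a + (v - w) *: spread y a + w *: y a.

Lemma motion_sym x y u v w :
  motion x y u v w = motion y x (1 - w) (1 - v) (1 - u).
Proof.
apply/funext => a; apply/rowP => c; rewrite /motion.
move: (spread x a) (spread y a) => p q; rewrite !mxE; ring.
Qed.

Lemma motion0 x y : motion x y 0 0 0 = x.
Proof.
by apply/funext => a; rewrite /motion !subr0 scale1r !scale0r !addr0.
Qed.

Lemma motion1 x y : motion x y 1 1 1 = y.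
Proof. by rewrite motion_sym subrr motion0. Qed.

Lemma conf_set_motion_first x y u : conf_set x -> 0 <= u <= 1 ->
  conf_set (motion x y u 0 0).
Proof.
(* At [u = 0] the shift separates nothing, and the hypothesis on [x] itself is needed. *)
move=> cx /andP[]; rewrite le_eqVlt => /orP[/eqP <- _|u0 u1].
  by rewrite motion0.
move=> a b; apply: contra_neq => /matrixP/(_ 0 i).
have k0 : 0 < k%:R :> R by rewrite ltr0n (leq_trans _ (ltn_ord a)).
have coordE c : motion x y u 0 0 c 0 i = x c 0 i + (u * (gap x / k%:R)) * c%:R.
  rewrite /motion; have := spread_fst x c.
  move: (spread x c) (spread y c) => p q; rewrite !mxE => ->; ring.
rewrite !coordE; apply: shift_injective.
  by rewrite mulr_gt0// divr_gt0// gap_gt0.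
by rewrite mulrA divfK ?gt_eqF// ler_piMl// ltW// gap_gt0.
Qed.

(** Both ends of this leg have second coordinate [a] at the point [a], hence so does every point
    between them. *)
Lemma conf_set_motion_middle x y v : conf_set (motion x y 1 v 0).
Proof.
move=> a b; apply: contra_neq => /matrixP/(_ 0 j).
have coordE c : motion x y 1 v 0 c 0 j = c%:R.
  rewrite /motion; have := spread_snd x c; have := spread_snd y c.
  move: (spread x c) (spread y c) => p q; rewrite !mxE => -> ->; ring.
by rewrite !coordE => /eqP; rewrite eqr_nat => /eqP /val_inj.
Qed.

Lemma conf_set_motion_last x y w : conf_set y -> 0 <= w <= 1 ->
  conf_set (motion x y 1 1 w).
Proof.
move=> cy w01; rewrite motion_sym subrr; apply: conf_set_motion_first => //.
by lra.
Qed.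

Definition clamp (t : R) : R := Num.max 0 (Num.min 1 t).

Lemma clamp0 t : t <= 0 -> clamp t = 0.
Proof. by move=> t0; rewrite /clamp min_r ?max_l//; lra. Qed.

Lemma clamp1 t : 1 <= t -> clamp t = 1.
Proof. by move=> t1; rewrite /clamp min_l// max_r. Qed.

Lemma clamp_itv t : 0 <= clamp t <= 1.
Proof. by rewrite /clamp le_max lexx /= ge_max ler01 ge_min lexx. Qed.

Lemma clamp_continuous : continuous clamp.
Proof.
move=> t; apply: (@continuous_max R R (cst 0)); first exact: cvg_cst.
by apply: (@continuous_min R R (cst 1)); [exact: cvg_cst|exact: cvg_id].
Qed.

(** Clamping lets one parameter move in each third of the unit interval while the others rest at 0
    or 1. The concatenation is thus continuous without gluing, and defined for every real [t]. *)
Definition path_motion (x y : E) (t : R) : E :=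
  motion x y (clamp (3 * t)) (clamp (3 * t - 1)) (clamp (3 * t - 2)).

Lemma path_motion0 x y : path_motion x y 0 = x.
Proof. by rewrite /path_motion !clamp0 ?motion0//; lra. Qed.

Lemma path_motion1 x y : path_motion x y 1 = y.
Proof. by rewrite /path_motion !clamp1 ?motion1//; lra. Qed.

Lemma conf_set_path_motion x y t : conf_set x -> conf_set y ->
  conf_set (path_motion x y t).
Proof.
move=> cx cy; rewrite /path_motion.
have [t1|t1] := leP (3 * t) 1.
  rewrite [clamp (3 * t - 1)]clamp0 ?[clamp (3 * t - 2)]clamp0; [|lra..].
  by apply: conf_set_motion_first => //; exact: clamp_itv.
have [t2|t2] := leP (3 * t) 2.
  rewrite [clamp (3 * t)]clamp1 ?[clamp (3 * t - 2)]clamp0; [|lra..].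
  exact: conf_set_motion_middle.
rewrite [clamp (3 * t)]clamp1 ?[clamp (3 * t - 1)]clamp1; [|lra..].
by apply: conf_set_motion_last => //; exact: clamp_itv.
Qed.

(** * Joint continuity of the motion in endpoints and time *)

Section continuity.
Context {X : topologicalType}.

(** A summand tied at [q] stays tied nearby, hence is locally the constant 0; without [ties] its
    inverse could blow up. An untied summand is the inverse of a nonzero continuous function. *)
Lemma gap_continuous (x : X -> E) : continuous x ->
  (forall q, \forall q' \near q, preserves_ties i (x q) (x q')) ->
  continuous (gap \o x).
Proof.
move=> cx ties q; apply: cvgV.
  by rewrite gt_eqF.
apply: cvgD; first exact: cvg_cst.
apply: (@cvg_big R^o _ +%R 0 _ add_continuous) => -[a b] _ /=.
have [xab|xab] := eqVneq (x q a 0 i) (x q b 0 i).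
  apply: (@cvg_near_cst _ _ _ _ _ (nbhs_filter q)).
  apply: (@filterS _ _ (nbhs_filter q)) (ties q) => q' /(_ a b xab) ->.
  by rewrite xab !subrr.
apply: cvgV.
  by rewrite normr_eq0 subr_eq0.
apply: cvg_norm; apply: cvgB.
  apply: (@continuous_comp _ E R x (fun x => x a 0 i)); first exact: cx.
  exact: eval_coord_continuous.
apply: (@continuous_comp _ E R x (fun x => x b 0 i)); first exact: cx.
exact: eval_coord_continuous.
Qed.

Lemma spread_continuous (x : X -> E) a :
  continuous x -> continuous (gap \o x) ->
  continuous (fun q => spread (x q) a).
Proof.
move=> cx cg q; apply: cvgD.
  apply: cvgD.
    apply: (@continuous_comp _ E _ x (fun x => x a)); first exact: cx.
    exact: (@proj_continuous 'I_k (fun=> 'rV[R]_n) a).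
  apply: cvgZr_tmp.
  apply: cvgMr_tmp; apply: cvgMr_tmp; exact: cg.
apply: cvgZr_tmp.
apply: cvgB; first exact: cvg_cst.
apply: (@continuous_comp _ E R x (fun x => x a 0 j)); first exact: cx.
exact: eval_coord_continuous.
Qed.

Lemma motion_continuous (x y : X -> E) (u v w : X -> R) :
  continuous x -> continuous y ->
  continuous (gap \o x) -> continuous (gap \o y) ->
  continuous u -> continuous v -> continuous w ->
  continuous (fun q => motion (x q) (y q) (u q) (v q) (w q)).
Proof.
move=> cx cy gx gy cu cv cw; apply: continuous_ptws => a q.
have eval (z : X -> E) : continuous z -> continuous (fun q => z q a).
  move=> cz p.
  apply: (@continuous_comp _ E _ z (fun z => z a)); first exact: cz.
  exact: (@proj_continuous 'I_k (fun=> 'rV[R]_n) a).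
apply: cvgD; last by apply: cvgZ; [exact: cw|exact: eval].
apply: cvgD; last first.
  by apply: cvgZ; [apply: cvgB; [exact: cv|exact: cw]|exact: spread_continuous].
apply: cvgD; last first.
  by apply: cvgZ; [apply: cvgB; [exact: cu|exact: cv]|exact: spread_continuous].
by apply: cvgZ; [apply: cvgB; [exact: cvg_cst|exact: cu]|exact: eval].
Qed.

Lemma path_motion_continuous (x y : X -> E) (t : X -> R) :
  continuous x -> continuous y ->
  continuous (gap \o x) -> continuous (gap \o y) -> continuous t ->
  continuous (fun q => path_motion (x q) (y q) (t q)).
Proof.
move=> cx cy gx gy ct.
have clampc (c : R) : continuous (fun q => clamp (3 * t q - c)).
  move=> q; apply: (@continuous_comp _ R R (fun q => 3 * t q - c) clamp).
    apply: cvgB; last exact: cvg_cst.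
    by apply: cvgM; [exact: cvg_cst|exact: ct].
  exact: clamp_continuous.
apply: motion_continuous => //.
by have := clampc 0; under eq_fun do rewrite subr0.
Qed.

End continuity.
End motion.

(** * Local rules as maps into the path space *)

Lemma path_space_curry (R : realType) (X Y : topologicalType)
    (f : X * unit_interval R -> Y) : continuous f ->
  exists2 s : X -> path_space R Y, continuous s &
    forall x t, path_at (s x) t = f (x, t).
Proof.
move=> /continuous_curry[cf cfx].
pose s x : path_space R Y := HB.pack_for (continuousType (unit_interval R) Y)
  (curry f x) (isContinuous.Build (unit_interval R) Y (curry f x) (cfx x)).
(* Paths carry the initial topology from the compact-open one, so continuity of the curried map
   suffices. *)
exists s => //; apply: continuous_comp_initial => x; exact: cf.
Qed.

Section local_rule.
Context {R : realType} {n k : nat} (i j : 'I_n).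
Hypothesis ij : i != j.
Local Notation conf := (conf R n k).

Definition conf_motion (xy : conf * conf) (t : R) : conf :=
  SigSub (mem_set (conf_set_path_motion ij t
    (set_mem (valP xy.1)) (set_mem (valP xy.2)))).

Lemma conf_motion0 xy : conf_motion xy 0 = xy.1.
Proof. by apply: val_inj; exact: path_motion0. Qed.

Lemma conf_motion1 xy : conf_motion xy 1 = xy.2.
Proof. by apply: val_inj; exact: path_motion1. Qed.

Lemma conf_motion_continuous m : continuous
  (fun q : set_type (@stratum R n k i m) * unit_interval R =>
    conf_motion (set_val q.1) (set_val q.2)).
Proof.
set Q := (set_type _ * _)%type.
have cfst : continuous (@fst _ _ : Q -> _) by move=> q; exact: cvg_fst.
have c1 (z : set_type (@stratum R n k i m) -> {ptws 'I_k -> 'rV[R]_n}) :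
  continuous z -> continuous (fun q : Q => z q.1).
  move=> cz q; apply: (@continuous_comp Q _ _ fst z); first exact: cvg_fst.
  exact: cz.
have cx : continuous
  (fun q : set_type (@stratum R n k i m) => set_val (set_val q).1).
  move=> w; apply: (@continuous_comp _ conf _ (fun w => (set_val w).1) set_val);
    first exact: continuous_val_fst.
  exact: set_val_continuous.
have cy : continuous
  (fun q : set_type (@stratum R n k i m) => set_val (set_val q).2).
  move=> w; apply: (@continuous_comp _ conf _ (fun w => (set_val w).2) set_val);
    first exact: continuous_val_snd.
  exact: set_val_continuous.
apply: continuous_comp_initial.
apply: path_motion_continuous.
- exact: (c1 _ cx).
- exact: (c1 _ cy).
(* Here the restriction to a stratum enters: [near_stratum] keeps the ties of both endpoints. *)
- apply: gap_continuous; first exact: (c1 _ cx).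
  move=> q; have := cfst q _ (near_stratum q.1).
  by apply: (@filterS _ _ (nbhs_filter q)) => q' [].
- apply: gap_continuous; first exact: (c1 _ cy).
  move=> q; have := cfst q _ (near_stratum q.1).
  by apply: (@filterS _ _ (nbhs_filter q)) => q' [].
- move=> q; apply: (@continuous_comp _ (unit_interval R)); first exact: cvg_snd.
  exact: set_val_continuous.
Qed.

End local_rule.

Theorem mainTheorem3 (R : realType) (n k : nat) (hn : (2 <= n)%N)
    (hk : (2 <= k)%N) :
  exists W : 'I_(2 * k - 1) -> set (conf R n k * conf R n k),
    [/\ trivIset [set: 'I_(2 * k - 1)] W,
        \bigcup_i W i = [set: conf R n k * conf R n k],
        (forall i, locally_compact [set: set_type (W i)]) &
        forall i, exists s : set_type (W i) -> path_space R (conf R n k),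
          continuous s /\
          forall w : set_type (W i),
            path_at (s w) (I0 R) = (set_val w).1 /\
            path_at (s w) (I1 R) = (set_val w).2].
Proof.
(* The axis [i0] carries the projections, and [i1] keeps points apart on the middle leg. *)
pose i0 : 'I_n := Ordinal (ltnW hn); pose i1 : 'I_n := Ordinal hn.
have i01 : i0 != i1 by [].
(* [nb_proj] is at least [1], so the first stratum is that of the sum [2]. *)
exists (fun l : 'I__ => stratum i0 l.+2); split.
- move=> l m _ _ [xy []]; rewrite /stratum /= => -> [lm].
  exact: val_inj.
- apply/seteqP; split=> // xy _.
  have k0 : (0 < k)%N by exact: ltnW.
  have [p pE] : exists p, p = nb_proj i0 (set_val xy.1) by eexists.
  have [q qE] : exists q, q = nb_proj i0 (set_val xy.2) by eexists.
  have p0 : (0 < p)%N by rewrite pE card_leaders_gt0.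
  have q0 : (0 < q)%N by rewrite qE card_leaders_gt0.
  have pk : (p <= k)%N by rewrite pE card_leaders_le.
  have qk : (q <= k)%N by rewrite qE card_leaders_le.
  (* Since [p] and [q] lie between 1 and [k], the index [p + q - 2] runs from 0 to [2 * k - 2]. *)
  have lt : (p + q - 2 < 2 * k - 1)%N by lia.
  by exists (Ordinal lt) => //; rewrite /stratum /= -pE -qE; lia.
- by move=> l; exact: stratum_locally_compact.
- move=> l.
  have [s cs sE] :=
    path_space_curry (@conf_motion_continuous R n k i0 i1 i01 l.+2).
  exists s; split=> // w; rewrite !sE; split.
    exact: conf_motion0.
  exact: conf_motion1.
Qed.
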